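(* Let $q\in\mathbb{C}$ with $|q|<1$, let $n$ be a non-negative integer, and let $b,x,y\in\mathbb{C}$ with $|xy|<1$ and $|by|<1$. Then \[ \sum_{m=0}^{\infty}\Phi_{m}^{(q^n)}(b,x|q)\,y^m=\frac{1}{1-xy}\;{}_{2}\varphi_{1}\left(\begin{array}{c} q^n,\,q\\ qxy\end{array};q,\,by\right). \]
   Context: For $a\in\mathbb{C}$ and integers $n\ge 0$, $(a;q)_n=\prod_{k=0}^{n-1}(1-q^k a)$. The $q$-binomial coefficient is $\genfrac{[}{]}{0pt}{}{m}{k}_q=\frac{(q;q)_m}{(q;q)_k(q;q)_{m-k}}$. The homogeneous Hahn polynomials are $\Phi_{m}^{(\alpha)}(x,y|q)=\sum_{k=0}^{m}\genfrac{[}{]}{0pt}{}{m}{k}_{q}(\alpha;q)_{k}x^ky^{m-k}$; thus $\Phi_{m}^{(q^n)}(b,x|q)=\sum_{k=0}^{m}\genfrac{[}{]}{0pt}{}{m}{k}_{q}(q^n;q)_{k}b^kx^{m-k}$. The basic hypergeometric series is \[ {}_{2}\varphi_{1}\left(\begin{array}{c} a_1,a_2\\ b_1\end{array};q,z\right)=\sum_{k=0}^{\infty}\frac{(a_1;q)_k(a_2;q)_k}{(q;q)_k(b_1;q)_k}z^k,\qquad |z|<1. \] *)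

(* Defs.v *)
From Stdlib Require Import Reals.
From Coquelicot Require Import Coquelicot.

Open Scope C_scope.

Fixpoint qpoch (a q : C) (n : nat) : C :=
  match n with
  | O => 1
  | S k => qpoch a q k * (1 - q ^ k * a)
  end.

(* Meaningful for [k <= m]: for [k > m] the truncated [m - k] makes this an
   irrelevant value. *)
Definition qbinom (q : C) (m k : nat) : C :=
  qpoch q q m / (qpoch q q k * qpoch q q (m - k)).

(* [sum_n u m] has the [m + 1] terms [u 0], ..., [u m]. *)
Definition hahn (q alpha : C) (m : nat) (x y : C) : C :=
  sum_n (fun k => qbinom q m k * qpoch alpha q k * x ^ k * y ^ (m - k)) m.

(* Coquelicot's [Series] is real-valued only; this is its complex counterpart,
   the sum of the series when it converges and a junk value otherwise. *)
Definition CSeries (u : nat -> C) : C :=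
  (Series (fun k => Re (u k)), Series (fun k => Im (u k))).

Definition phi21_term (a1 a2 b1 q z : C) (k : nat) : C :=
  (qpoch a1 q k * qpoch a2 q k) / (qpoch q q k * qpoch b1 q k) * z ^ k.

Definition phi21 (a1 a2 b1 q z : C) : C := CSeries (phi21_term a1 a2 b1 q z).

(* Main.v *)
(* Expanding [hahn] and summing first over [m] with [m - k = j], the theorem
   reduces to the q-binomial series
   [sum_j qbinom (k + j) k * z ^ j = 1 / qpoch z q (k + 1)], [z = x * y].
   The truncation of this series at [j = N] has an explicit error term, which
   is [O(|z| ^ N)] uniformly in [k] because the q-Pochhammer symbols are bounded
   and bounded away from 0. The error made on the [M]-th partial sum is thus
   dominated by a term of the Cauchy product of two convergent geometric
   series, and tends to 0. *)
Require Import Defs.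
From Stdlib Require Import Reals Lra Lia.
From Coquelicot Require Import Coquelicot.

Open Scope C_scope.

(** * Finite sums over [C], stated with the field operations of [C] *)

Lemma csum_Sn (u : nat -> C) (n : nat) :
  @sum_n C_AbelianMonoid u (S n) = @sum_n C_AbelianMonoid u n + u (S n).
Proof. exact (@sum_Sn C_AbelianMonoid u n). Qed.

Lemma csum_O (u : nat -> C) : @sum_n C_AbelianMonoid u 0 = u O.
Proof. exact (@sum_O C_AbelianMonoid u). Qed.

Lemma csum_mult_l (a : C) (u : nat -> C) (n : nat) :
  @sum_n C_AbelianMonoid (fun k => a * u k) n = a * @sum_n C_AbelianMonoid u n.
Proof. exact (@sum_n_mult_l C_Ring a u n). Qed.

Lemma csum_plus (u v : nat -> C) (n : nat) :
  @sum_n C_AbelianMonoid (fun k => u k + v k) n =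
  @sum_n C_AbelianMonoid u n + @sum_n C_AbelianMonoid v n.
Proof. exact (@sum_n_plus C_AbelianMonoid u v n). Qed.

Lemma csum_ext_loc (u v : nat -> C) (n : nat) :
  (forall k, (k <= n)%nat -> u k = v k) ->
  @sum_n C_AbelianMonoid u n = @sum_n C_AbelianMonoid v n.
Proof. exact (@sum_n_ext_loc C_AbelianMonoid u v n). Qed.

(** Passing from [M] to [S M] lengthens each row [k <= M] by [f k (S M - k)] and opens the row
    [k = S M] with one entry; together these form the new antidiagonal. *)
Lemma csum_triangle (f : nat -> nat -> C) (M : nat) :
  @sum_n C_AbelianMonoid
    (fun m => @sum_n C_AbelianMonoid (fun k => f k (m - k)%nat) m) M =
  @sum_n C_AbelianMonoid
    (fun k => @sum_n C_AbelianMonoid (f k) (M - k)) M.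
Proof.
  induction M as [|M IH].
  - now rewrite !csum_O.
  - rewrite csum_Sn, IH, !csum_Sn, Nat.sub_diag, csum_O, Cplus_assoc.
    f_equal. rewrite <- csum_plus.
    apply csum_ext_loc. intros k Hk.
    replace (S M - k)%nat with (S (M - k)) by lia.
    now rewrite csum_Sn.
Qed.

Lemma Cmod_csum_le (u : nat -> C) (v : nat -> R) (n : nat) :
  (forall k, (k <= n)%nat -> (Cmod (u k) <= v k)%R) ->
  (Cmod (@sum_n C_AbelianMonoid u n) <= sum_f_R0 v n)%R.
Proof.
  induction n as [|n IH]; intros H.
  - rewrite csum_O. now apply H.
  - rewrite csum_Sn. simpl.
    eapply Rle_trans; [apply Cmod_triangle|].
    apply Rplus_le_compat; [apply IH; intros; apply H; lia | now apply H].
Qed.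

(** * Bounds for q-Pochhammer symbols, uniform in the number of factors *)

Lemma Cmod_pow_le_1 (q : C) (k : nat) :
  (Cmod q < 1)%R -> (0 <= Cmod q ^ k <= 1)%R.
Proof.
  intros hq. pose proof (Cmod_ge_0 q). split.
  - now apply pow_le.
  - rewrite <- (pow1 k). apply pow_incr. lra.
Qed.

Lemma Cmod_one_minus_ge (w : C) : (1 - Cmod w <= Cmod (1 - w))%R.
Proof.
  pose proof (Cmod_triangle (1 - w) w) as H.
  replace (1 - w + w) with (RtoC 1) in H by ring.
  rewrite Cmod_1 in H. lra.
Qed.

Lemma Cmod_one_minus_le (w : C) : (Cmod (1 - w) <= 1 + Cmod w)%R.
Proof.
  pose proof (Cmod_triangle 1 (- w)) as H.
  now rewrite Cmod_1, Cmod_opp in H.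
Qed.

Lemma geom_sum_bound (r : R) (k : nat) :
  (0 <= r < 1)%R -> (sum_f_R0 (pow r) k <= / (1 - r))%R.
Proof.
  intros Hr. rewrite tech3 by lra.
  pose proof (pow_le r (S k) (proj1 Hr)).
  apply Rmult_le_reg_r with (1 - r)%R; [lra|].
  field_simplify; lra.
Qed.

Lemma exp_le (u v : R) : (u <= v)%R -> (exp u <= exp v)%R.
Proof.
  intros [H| ->]; [now apply Rlt_le, exp_increasing | apply Rle_refl].
Qed.

(** Each factor has modulus at most [1 + |a||q|^k <= exp (|a||q|^k)], and the exponents add up to at
    most [|a| / (1 - |q|)]. *)
Lemma qpoch_upper (q a : C) : (Cmod q < 1)%R ->
  exists U : R, (0 < U)%R /\ forall k, (Cmod (qpoch a q k) <= U)%R.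
Proof.
  intros hq.
  pose proof (Cmod_ge_0 q) as Hq0. pose proof (Cmod_ge_0 a) as Ha0.
  (* [sum_f_R0 _ k] has [k + 1] terms, one for each factor of [qpoch a q (S k)]; the empty product
     is treated separately. *)
  assert (Hk : forall k, (Cmod (qpoch a q (S k)) <=
                exp (Cmod a * sum_f_R0 (pow (Cmod q)) k))%R).
  { assert (Hs : forall k, (Cmod (1 - q ^ k * a) <=
                  exp (Cmod a * Cmod q ^ k))%R).
    { intros k. eapply Rle_trans; [apply Cmod_one_minus_le|].
      rewrite Cmod_mult, Cmod_pow, Rmult_comm. apply exp_ineq1_le. }
    induction k as [|k IH].
    - simpl qpoch. simpl sum_f_R0. rewrite Cmult_1_l. apply (Hs 0%nat).
    - change (qpoch a q (S (S k))) with (qpoch a q (S k) * (1 - q ^ S k * a)).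
      rewrite tech5, Rmult_plus_distr_l, exp_plus, Cmod_mult.
      apply Rmult_le_compat; auto using Cmod_ge_0. }
  assert (Hexp : forall v, (0 <= v -> 1 <= exp v)%R).
  { intros v Hv. pose proof (exp_ineq1_le v). lra. }
  assert (Hinv : (0 < / (1 - Cmod q))%R) by (apply Rinv_0_lt_compat; lra).
  exists (exp (Cmod a * / (1 - Cmod q))). split; [apply exp_pos|].
  intros [|k].
  - simpl. rewrite Cmod_1. apply Hexp, Rmult_le_pos; lra.
  - eapply Rle_trans; [apply Hk|]. apply exp_le.
    apply Rmult_le_compat_l; [easy|]. apply geom_sum_bound. lra.
Qed.

(** With [v = p t / (1 - t)], the product [(1 - p t)(1 + v)] equals
    [1 + p (1 - p) t^2 / (1 - t) >= 1], and [1 + v <= exp v]. The exponent is linear in [p], so that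
    it can be summed over [p = |q|^k]. *)
Lemma exp_opp_le_one_minus (t p : R) :
  (0 <= t < 1)%R -> (0 <= p <= 1)%R ->
  (exp (- (t / (1 - t) * p)) <= 1 - p * t)%R.
Proof.
  intros Ht Hp.
  assert (Hinv : (0 < / (1 - t))%R) by (apply Rinv_0_lt_compat; lra).
  set (v := (t / (1 - t) * p)%R).
  assert (Hv : (0 <= v)%R).
  { unfold v, Rdiv. apply Rmult_le_pos; [apply Rmult_le_pos|]; lra. }
  assert (Hpt : (p * t <= t)%R) by nra.
  assert (H1 : (1 <= (1 - p * t) * (1 + v))%R).
  { replace ((1 - p * t) * (1 + v))%R
      with (1 + p * (1 - p) * t ^ 2 * / (1 - t))%R by (unfold v; field; lra).
    assert (0 <= p * (1 - p) * t ^ 2 * / (1 - t))%R; [|lra].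
    repeat apply Rmult_le_pos; lra || (apply pow_le; lra). }
  rewrite exp_Ropp. pose proof (exp_ineq1_le v).
  apply Rmult_le_reg_r with (exp v); [apply exp_pos|].
  rewrite Rinv_l by (apply Rgt_not_eq, exp_pos).
  eapply Rle_trans; [apply H1|]. apply Rmult_le_compat_l; lra.
Qed.

(** Each factor has modulus at least [1 - |q|^k |a| >= exp (- L |q|^k)] with [L = |a| / (1 - |a|)],
    and the powers of [|q|] have a bounded sum. *)
Lemma qpoch_lower (q a : C) : (Cmod q < 1)%R -> (Cmod a < 1)%R ->
  exists c : R, (0 < c)%R /\ forall k, (c <= Cmod (qpoch a q k))%R.
Proof.
  intros hq ha.
  pose proof (Cmod_ge_0 q) as Hq0. pose proof (Cmod_ge_0 a) as Ha0.
  set (L := (Cmod a / (1 - Cmod a))%R).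
  assert (HL : (0 <= L)%R).
  { apply Rmult_le_pos; [easy|]. apply Rlt_le, Rinv_0_lt_compat. lra. }
  assert (Hk : forall k,
    (exp (- (L * sum_f_R0 (pow (Cmod q)) k)) <= Cmod (qpoch a q (S k)))%R).
  { assert (Hs : forall k, (exp (- (L * Cmod q ^ k)) <=
                             Cmod (1 - q ^ k * a))%R).
    { intros k. eapply Rle_trans; [|apply Cmod_one_minus_ge].
      rewrite Cmod_mult, Cmod_pow.
      apply exp_opp_le_one_minus; [lra | now apply Cmod_pow_le_1]. }
    induction k as [|k IH].
    - simpl qpoch. simpl sum_f_R0. rewrite Cmult_1_l. apply (Hs 0%nat).
    - change (qpoch a q (S (S k))) with (qpoch a q (S k) * (1 - q ^ S k * a)).
      rewrite tech5, Rmult_plus_distr_l, Ropp_plus_distr, exp_plus, Cmod_mult.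
      apply Rmult_le_compat; auto using Rlt_le, exp_pos. }
  assert (Hinv : (0 < / (1 - Cmod q))%R) by (apply Rinv_0_lt_compat; lra).
  exists (exp (- (L * / (1 - Cmod q)))). split; [apply exp_pos|].
  intros [|k].
  - simpl. rewrite Cmod_1. eapply Rle_trans; [|apply Req_le, exp_0]. apply exp_le.
    assert (0 <= L * / (1 - Cmod q))%R by (apply Rmult_le_pos; lra). lra.
  - eapply Rle_trans; [|apply Hk]. apply exp_le, Ropp_le_contravar.
    apply Rmult_le_compat_l; [easy|]. apply geom_sum_bound. lra.
Qed.

Lemma qpoch_neq_0 (q a : C) (k : nat) : (Cmod q < 1)%R -> (Cmod a < 1)%R ->
  qpoch a q k <> 0.
Proof.
  intros hq ha H. destruct (qpoch_lower q a hq ha) as [c [Hc Hk]].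
  specialize (Hk k). rewrite H, Cmod_0 in Hk. lra.
Qed.

(** The definition splits off the last factor; splitting off the first one relates the lower
    parameter [q * z] of the series to [qpoch z q (S k)]. *)
Lemma qpoch_shift (q a : C) (k : nat) :
  qpoch a q (S k) = (1 - a) * qpoch (q * a) q k.
Proof.
  induction k as [|k IH].
  - simpl. ring.
  - change (qpoch a q (S (S k))) with (qpoch a q (S k) * (1 - q ^ S k * a)).
    rewrite IH. simpl. ring.
Qed.

(** * q-binomial coefficients *)

Lemma qbinom_bounded (q : C) : (Cmod q < 1)%R ->
  exists K : R, (0 < K)%R /\
    forall k j, (Cmod (qbinom q (k + j) k) <= K)%R.
Proof.
  intros hq.
  destruct (qpoch_upper q q hq) as [U [HU HUk]].
  destruct (qpoch_lower q q hq hq) as [c [Hc Hck]].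
  exists (U * / (c * c))%R. split.
  - apply Rmult_lt_0_compat; [easy|]. apply Rinv_0_lt_compat. nra.
  - intros k j. unfold qbinom.
    rewrite Cmod_div, Cmod_mult
      by (apply Cmult_neq_0; now apply qpoch_neq_0).
    apply Rmult_le_compat; [apply Cmod_ge_0 | | apply HUk |].
    + apply Rlt_le, Rinv_0_lt_compat, Rmult_lt_0_compat;
        eapply Rlt_le_trans; [apply Hc | apply Hck | apply Hc | apply Hck].
    + apply Rinv_le_contravar; [nra|].
      apply Rmult_le_compat; try apply Hck; lra.
Qed.

(** Over a common denominator this is [1 - q^(k+j+2) = (1 - q^(k+1)) + q^(k+1) (1 - q^(j+1))]. *)
Lemma qbinom_pascal (q : C) (k j : nat) : (Cmod q < 1)%R ->
  qbinom q (S k + S j) (S k) =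
  qbinom q (k + S j) k + q ^ S k * qbinom q (S k + j) (S k).
Proof.
  intros hq. unfold qbinom.
  replace (S k + S j - S k)%nat with (S j) by lia.
  replace (k + S j - k)%nat with (S j) by lia.
  replace (S k + j - S k)%nat with j by lia.
  replace (S k + S j)%nat with (S (S (k + j))) by lia.
  replace (k + S j)%nat with (S (k + j)) by lia.
  replace (S k + j)%nat with (S (k + j)) by lia.
  pose proof (qpoch_neq_0 q q (S k) hq hq) as H1.
  pose proof (qpoch_neq_0 q q (S j) hq hq) as H2.
  change (qpoch q q (S (S (k + j))))
    with (qpoch q q (S (k + j)) * (1 - q ^ S (k + j) * q)).
  (* This factor is common to the three numerators; abstracting it keeps it from being unfolded. *)
  generalize (qpoch q q (S (k + j))). intros P.
  simpl qpoch in *. simpl Cpow. rewrite Cpow_add_r.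
  assert (qpoch q q k <> 0) by now apply qpoch_neq_0.
  assert (qpoch q q j <> 0) by now apply qpoch_neq_0.
  assert (1 - q ^ k * q <> 0) by (intros E; apply H1; rewrite E; ring).
  assert (1 - q ^ j * q <> 0) by (intros E; apply H2; rewrite E; ring).
  field. auto.
Qed.

Lemma qbinom_0_r (q : C) (m : nat) : (Cmod q < 1)%R -> qbinom q m 0 = 1.
Proof.
  intros hq. unfold qbinom. rewrite Nat.sub_0_r. simpl.
  field. now apply qpoch_neq_0.
Qed.

Lemma qbinom_diag (q : C) (m : nat) : (Cmod q < 1)%R -> qbinom q m m = 1.
Proof.
  intros hq. unfold qbinom. rewrite Nat.sub_diag. simpl.
  field. now apply qpoch_neq_0.
Qed.

(** * The truncated q-binomial series and its remainder *)

Definition qbinom_sum (q z : C) (k N : nat) : C :=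
  @sum_n C_AbelianMonoid (fun j => qbinom q (k + j) k * z ^ j) N.

(** By the Pascal rule, the sum for [S k] is the sum for [k] plus [q^(k+1) z] times itself without
    its last term; that term is the correction. *)
Lemma qbinom_sum_rec (q z : C) (k N : nat) : (Cmod q < 1)%R ->
  (1 - q ^ S k * z) * qbinom_sum q z (S k) N =
  qbinom_sum q z k N - q ^ S k * z ^ S N * qbinom q (S k + N) (S k).
Proof.
  intros hq. unfold qbinom_sum. induction N as [|N IH].
  - rewrite !csum_O, !Nat.add_0_r, !qbinom_diag by easy. simpl. ring.
  - rewrite !csum_Sn, Cmult_plus_distr_l, IH, qbinom_pascal by easy.
    simpl Cpow. ring.
Qed.

(** The case [k = 0] is the finite geometric sum. Each further factor [1 - q^(k+1) z] lowers the
    index by the recurrence and leaves one more term in the remainder. *)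
Lemma qbinom_sum_closed (q z : C) (k N : nat) : (Cmod q < 1)%R ->
  qpoch z q (S k) * qbinom_sum q z k N =
  1 - z ^ S N * @sum_n C_AbelianMonoid
                  (fun i => q ^ i * qbinom q (i + N) i * qpoch z q i) k.
Proof.
  intros hq. induction k as [|k IH].
  - rewrite csum_O, qbinom_0_r by easy.
    replace (qpoch z q 1) with (1 - z) by (simpl; ring).
    replace (q ^ 0 * 1 * qpoch z q 0) with (RtoC 1) by (simpl; ring).
    unfold qbinom_sum. induction N as [|N IHN].
    + rewrite csum_O, qbinom_0_r by easy. simpl. ring.
    + rewrite csum_Sn, Cmult_plus_distr_l, IHN, qbinom_0_r by easy.
      simpl. ring.
  - change (qpoch z q (S (S k))) with (qpoch z q (S k) * (1 - q ^ S k * z)).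
    rewrite <- Cmult_assoc, qbinom_sum_rec by easy.
    unfold Cminus at 1. rewrite Cmult_plus_distr_l, IH, csum_Sn. ring.
Qed.

(** The factor [q^i] in the remainder makes its sum bounded independently of [k] and [N]. *)
Lemma qbinom_sum_error (q z : C) : (Cmod q < 1)%R -> (Cmod z < 1)%R ->
  exists K : R, (0 < K)%R /\ forall k N,
    (Cmod (qbinom_sum q z k N - / qpoch z q (S k)) <= K * Cmod z ^ N)%R.
Proof.
  intros hq hz.
  destruct (qbinom_bounded q hq) as [B [HB HBk]].
  destruct (qpoch_upper q z hq) as [U [HU HUk]].
  destruct (qpoch_lower q z hq hz) as [c [Hc Hck]].
  pose proof (Cmod_ge_0 q) as Hq0. pose proof (Cmod_ge_0 z) as Hz0.
  assert (Hinv : (0 < / (1 - Cmod q))%R) by (apply Rinv_0_lt_compat; lra).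
  assert (Hcinv : (0 < / c)%R) by now apply Rinv_0_lt_compat.
  exists (B * U * / (1 - Cmod q) * / c)%R. split.
  { repeat apply Rmult_lt_0_compat; easy. }
  intros k N.
  pose proof (qpoch_neq_0 q z (S k) hq hz) as Hnz.
  set (E := @sum_n C_AbelianMonoid
              (fun i => q ^ i * qbinom q (i + N) i * qpoch z q i) k).
  assert (HE : (Cmod E <= B * U * / (1 - Cmod q))%R).
  { eapply Rle_trans.
    - apply (Cmod_csum_le _ (fun i => Cmod q ^ i * (B * U))%R).
      intros i _. rewrite !Cmod_mult, Cmod_pow, Rmult_assoc.
      apply Rmult_le_compat_l; [now apply pow_le|].
      apply Rmult_le_compat; auto using Cmod_ge_0.
    - rewrite <- scal_sum. apply Rmult_le_compat_l; [nra|].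
      apply geom_sum_bound. lra. }
  replace (qbinom_sum q z k N - / qpoch z q (S k))
    with (- (z ^ S N * E * / qpoch z q (S k))).
  2:{ pose proof (qbinom_sum_closed q z k N hq) as H. fold E in H.
      replace (z ^ S N * E)
        with (1 - qpoch z q (S k) * qbinom_sum q z k N)
        by (rewrite H; ring).
      now field. }
  rewrite Cmod_opp, !Cmod_mult, Cmod_inv, Cmod_pow by easy.
  (* The remainder carries [z^(N+1)]; the spare factor [|z|] is given away. *)
  assert (HzN : (0 <= Cmod z ^ S N <= Cmod z ^ N)%R).
  { split; [now apply pow_le|]. simpl.
    pose proof (pow_le _ N Hz0). nra. }
  rewrite (Rmult_comm _ (Cmod z ^ N)), <- Rmult_assoc.
  apply Rmult_le_compat.
  - apply Rmult_le_pos; [easy | apply Cmod_ge_0].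
  - apply Rlt_le, Rinv_0_lt_compat. eapply Rlt_le_trans; [apply Hc|apply Hck].
  - apply Rmult_le_compat; try easy. apply Cmod_ge_0.
  - now apply Rinv_le_contravar.
Qed.

(** * Convergence of the series involved *)

(** A ball of [C] is a product of two real balls here, so real and imaginary parts converge
    separately and [CSeries u] is the true sum, not a junk value. *)
Lemma is_series_CSeries (u : nat -> C) :
  @ex_series C_AbsRing C_NormedModule u ->
  @is_series C_AbsRing C_NormedModule u (CSeries u).
Proof.
  intros [l Hl].
  assert (Hsum : forall N, @sum_n C_AbelianMonoid u N =
    (sum_n (fun k => Re (u k)) N, sum_n (fun k => Im (u k)) N)).
  { induction N as [|N IH].
    - rewrite csum_O, !sum_O. apply surjective_pairing.
    - now rewrite csum_Sn, IH, !sum_Sn. }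
  unfold CSeries.
  rewrite (is_series_unique _ (Re l)), (is_series_unique _ (Im l));
    [now destruct l | |];
    intros P [eps HP];
    destruct (Hl _ (locally_ball l eps)) as [N HN];
    exists N; intros n Hn; apply HP; specialize (HN n Hn);
    change (ball l eps (@sum_n C_AbelianMonoid u n)) in HN;
    rewrite Hsum in HN; apply HN.
Qed.

(** These are the terms of the Cauchy product of two absolutely convergent series; the argument also
    covers [r = s]. *)
Lemma geom_convolution_lim_0 (r s : R) :
  (0 <= r < 1)%R -> (0 <= s < 1)%R ->
  is_lim_seq (fun M => sum_f_R0 (fun k => (s ^ k * r ^ (M - k))%R) M) 0.
Proof.
  intros Hr Hs. apply ex_series_lim_0.
  assert (Habs : forall t, (0 <= t < 1)%R -> (Rabs t < 1)%R)
    by (intros; rewrite Rabs_pos_eq; lra).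
  assert (Hpow : forall t, (0 <= t < 1)%R ->
    ex_series (fun n => Rabs (t ^ n))).
  { intros t Ht. apply ex_series_ext with (fun n => (t ^ n)%R).
    - intros n. symmetry. apply Rabs_pos_eq, pow_le. lra.
    - now apply ex_series_geom, Habs. }
  eexists. apply is_series_mult; auto; apply is_series_geom; auto.
Qed.

(** The upper parameter [q] cancels [qpoch q q k], and [1 - z] completes [qpoch (q * z) q k] to
    [qpoch z q (S k)]. *)
Lemma phi21_term_qpoch (a q z w : C) (k : nat) :
  (Cmod q < 1)%R -> (Cmod z < 1)%R ->
  1 / (1 - z) * phi21_term a q (q * z) q w k =
  qpoch a q k * w ^ k * / qpoch z q (S k).
Proof.
  intros hq hz. unfold phi21_term.
  pose proof (qpoch_neq_0 q z (S k) hq hz) as H. rewrite qpoch_shift in *.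
  assert (1 - z <> 0) by (intros E; apply H; rewrite E; ring).
  assert (qpoch (q * z) q k <> 0) by (intros E; apply H; rewrite E; ring).
  assert (qpoch q q k <> 0) by now apply qpoch_neq_0.
  field. auto.
Qed.

Lemma ex_series_phi21_term (a q z w : C) :
  (Cmod q < 1)%R -> (Cmod z < 1)%R -> (Cmod w < 1)%R ->
  @ex_series C_AbsRing C_NormedModule (phi21_term a q (q * z) q w).
Proof.
  intros hq hz hw.
  destruct (qpoch_upper q a hq) as [U [HU HUk]].
  destruct (qpoch_lower q z hq hz) as [c [Hc Hck]].
  assert (Hnz : 1 - z <> 0).
  { intros E. pose proof (Cmod_one_minus_ge z) as H.
    rewrite E, Cmod_0 in H. lra. }
  apply (@ex_series_le C_AbsRing C_CompleteNormedModule _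
           (fun k => Cmod (1 - z) * (U * / c) * Cmod w ^ k)%R).
  - intros k. change (Cmod (phi21_term a q (q * z) q w k) <=
                      Cmod (1 - z) * (U * / c) * Cmod w ^ k)%R.
    (* Restoring the prefactor turns the denominator into [qpoch z q (S k)], which is bounded below
       by [c]. *)
    replace (phi21_term a q (q * z) q w k) with
      ((1 - z) * (1 / (1 - z) * phi21_term a q (q * z) q w k))
      by now field.
    rewrite phi21_term_qpoch, !Cmod_mult, Cmod_inv, Cmod_pow
      by auto using qpoch_neq_0.
    rewrite (Rmult_assoc (Cmod (1 - z))).
    apply Rmult_le_compat_l; [apply Cmod_ge_0|].
    replace (U * / c * Cmod w ^ k)%R with (U * Cmod w ^ k * / c)%R by ring.
    pose proof (pow_le _ k (Cmod_ge_0 w)).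
    apply Rmult_le_compat.
    + apply Rmult_le_pos; [apply Cmod_ge_0 | easy].
    + apply Rlt_le, Rinv_0_lt_compat. eapply Rlt_le_trans; [apply Hc|apply Hck].
    + now apply Rmult_le_compat_r.
    + now apply Rinv_le_contravar.
  - apply (@ex_series_scal_l R_AbsRing R_NormedModule
             (Cmod (1 - z) * (U * / c))%R (pow (Cmod w))).
    apply ex_series_geom. rewrite Rabs_pos_eq; [easy | apply Cmod_ge_0].
Qed.

(** * The generating function *)

(** Writing [y^m = y^k y^(m-k)] makes each term a function of [k] and [j = m - k]; the triangle
    [k + j <= M] is then summed by rows. *)
Lemma hahn_partial_sum (q a b x y : C) (M : nat) :
  @sum_n C_AbelianMonoid (fun m => hahn q a m b x * y ^ m) M =
  @sum_n C_AbelianMonoid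
    (fun k => qpoch a q k * (b * y) ^ k * qbinom_sum q (x * y) k (M - k)) M.
Proof.
  pose (f := fun k j => qpoch a q k * (b * y) ^ k *
                        (qbinom q (k + j) k * (x * y) ^ j)).
  transitivity (@sum_n C_AbelianMonoid
    (fun m => @sum_n C_AbelianMonoid (fun k => f k (m - k)%nat) m) M).
  - apply csum_ext_loc. intros m _.
    unfold hahn. rewrite Cmult_comm, <- csum_mult_l.
    apply csum_ext_loc. intros k Hk. unfold f.
    replace (k + (m - k))%nat with m by lia.
    rewrite !Cpow_mult_l.
    replace (y ^ m) with (y ^ k * y ^ (m - k))
      by (rewrite <- Cpow_add_r; f_equal; lia).
    ring.
  - rewrite csum_triangle. apply csum_ext_loc. intros k _.
    unfold f, qbinom_sum. now rewrite csum_mult_l.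
Qed.

Theorem theorem7 (q : C) (n : nat) (b x y : C)
  (hq : (Cmod q < 1)%R) (hxy : (Cmod (x * y) < 1)%R)
  (hby : (Cmod (b * y) < 1)%R) :
  @ex_series C_AbsRing C_NormedModule
    (phi21_term (q ^ n) q (q * x * y) q (b * y)) /\
  @is_series C_AbsRing C_NormedModule
    (fun m => hahn q (q ^ n) m b x * y ^ m)
    (1 / (1 - x * y) * phi21 (q ^ n) q (q * x * y) q (b * y)).
Proof.
  rewrite <- Cmult_assoc. set (z := x * y) in *.
  pose proof (ex_series_phi21_term (q ^ n) q z (b * y) hq hxy hby) as Hex.
  split; [exact Hex|].
  apply is_series_CSeries in Hex.
  fold (phi21 (q ^ n) q (q * z) q (b * y)) in Hex.
  apply (is_series_scal_l (1 / (1 - z))) in Hex.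
  unfold is_series in Hex |- *.
  set (l := 1 / (1 - z) * phi21 (q ^ n) q (q * z) q (b * y)).
  (* [P] collects the partial sums of the right-hand side. [E] below is the error made by replacing
     each truncated q-binomial series with its limit. *)
  set (P := fun M => @sum_n C_AbelianMonoid
    (fun k => 1 / (1 - z) * phi21_term (q ^ n) q (q * z) q (b * y) k) M).
  change (filterlim P eventually (@locally C_NormedModule l)) in Hex.
  set (E := fun M => @sum_n C_AbelianMonoid
    (fun k => qpoch (q ^ n) q k * (b * y) ^ k *
      (qbinom_sum q z k (M - k) - / qpoch z q (S k))) M).
  assert (HE : filterlim E eventually (@locally C_NormedModule zero)).
  { apply filterlim_norm_zero.
    destruct (qpoch_upper q (q ^ n) hq) as [U [HU HUk]].
    destruct (qbinom_sum_error q z hq hxy) as [K [HK HKk]].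
    pose proof (Cmod_ge_0 z) as Hz0.
    pose proof (Cmod_ge_0 (b * y)) as Hw0.
    (* Truncating row [k] at [M - k] costs at most [K |z|^(M-k)], and its coefficient is at most
       [U |b y|^k]. *)
    apply (is_lim_seq_le_le (fun _ => 0%R) _ (fun M => (U * K) *
      sum_f_R0 (fun k => (Cmod (b * y) ^ k * Cmod z ^ (M - k))%R) M)%R 0).
    - intros M. split; [apply (@norm_ge_0 C_AbsRing C_NormedModule)|].
      change (Cmod (E M) <= U * K *
        sum_f_R0 (fun k => (Cmod (b * y) ^ k * Cmod z ^ (M - k))%R) M)%R.
      rewrite scal_sum. apply Cmod_csum_le. intros k _.
      rewrite !(Cmod_mult (_ * _)), (Cmod_mult (qpoch _ _ _)), Cmod_pow.
      pose proof (pow_le _ k Hw0).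
      replace (Cmod (b * y) ^ k * Cmod z ^ (M - k) * (U * K))%R
        with (U * Cmod (b * y) ^ k * (K * Cmod z ^ (M - k)))%R by ring.
      apply Rmult_le_compat; auto using Cmod_ge_0.
      + apply Rmult_le_pos; auto using Cmod_ge_0.
      + now apply Rmult_le_compat_r.
    - apply is_lim_seq_const.
    - rewrite <- (Rmult_0_r (U * K)).
      apply (is_lim_seq_scal_l _ (U * K) 0).
      apply geom_convolution_lim_0; lra. }
  (* The partial sums of the left-hand side are exactly [P M + E M], since the terms in
     [/ qpoch z q (S k)] cancel. *)
  apply filterlim_ext with (fun M => plus (P M : C_NormedModule) (E M)).
  - intros M. transitivity (P M + E M); [reflexivity|].
    unfold P, E. rewrite <- csum_plus.
    etransitivity; [|symmetry; apply hahn_partial_sum].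
    apply csum_ext_loc. intros k _.
    rewrite phi21_term_qpoch by easy. fold z. ring.
  - rewrite <- (plus_zero_r (l : C_NormedModule)).
    eapply filterlim_comp_2; [exact Hex | exact HE |].
    apply (@filterlim_plus C_AbsRing C_NormedModule).
Qed.
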